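(* Let $p=p(n)$ be a sequence satisfying $n^{-1/9}\log^2 n<p(n)<1-n^{-1/9}\log^2 n$ for all sufficiently large $n$. Then asymptotically almost surely a random digraph $D\in D(n,p(n))$ is a core; that is, the probability that $D$ is a core tends to $1$ as $n\to\infty$.
   Context: Digraphs are simple: loopless and without multiple arcs, but two oppositely directed arcs $uv$ and $vu$ between the same two vertices are allowed. $V(D)$ and $A(D)$ denote the vertex set and arc set of $D$. A cycle in a digraph is a directed cycle (two oppositely directed arcs $uv,vu$ form a directed cycle of length 2); a digraph is acyclic if it contains no directed cycle. For a natural number $n$ and $0\le p\le 1$, $D(n,p)$ is the random digraph on vertex set $[n]=\{1,\dots,n\}$ in which each ordered pair of distinct vertices is joined by an arc with probability $p$, with the arcs chosen independently. A digraph property holds asymptotically almost surely (a.a.s.) if its probability tends to $1$ as $n\to\infty$. An acyclic homomorphism of a digraph $D$ to a digraph $C$ is a function $\rho\colon V(D)\to V(C)$ such that: (i) for every arc $uv\in A(D)$, either $\rho(u)=\rho(v)$, or $\rho(u)\rho(v)$ is an arc of $C$; and (ii) for every vertex $v\in V(C)$, the subdigraph of $D$ induced by $\rho^{-1}(v)$ is acyclic. A digraph $D$ is a core if the only acyclic homomorphisms of $D$ to itself are automorphisms of $D$. Here $\log$ is the natural logarithm. *)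

(* Defs.v *)
From HB Require Import structures.
From mathcomp Require Import all_boot all_order all_algebra.
From mathcomp Require Import all_classical all_reals all_analysis.

Set Implicit Arguments.
Unset Strict Implicit.
Unset Printing Implicit Defensive.

Import Order.TTheory GRing.Theory Num.Theory.
Import numFieldNormedType.Exports.

Local Open Scope ring_scope.

Record digraph (V : finType) := Digraph {
  arcs : {set V * V};
  arcs_loopless : [forall v, (v, v) \notin arcs]
}.

HB.instance Definition _ (V : finType) := [isSub for @arcs V].
HB.instance Definition _ (V : finType) := [Finite of digraph V by <:].

Definition arcb (V : finType) (D : digraph V) : rel V :=
  fun u v => (u, v) \in arcs D.

Definition induced_arcs (V : finType) (D : digraph V) (S : {set V}) :
    {set {x : V | x \in S} * {x : V | x \in S}} :=
  [set e | arcb D (val e.1) (val e.2)].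

Lemma induced_loopless (V : finType) (D : digraph V) (S : {set V}) :
  [forall v, (v, v) \notin induced_arcs D S].
Proof.
apply/forallP => v; rewrite inE /arcb /=.
by have /forallP/(_ (val v)) := arcs_loopless D.
Qed.

Definition induced (V : finType) (D : digraph V) (S : {set V}) :
    digraph {x : V | x \in S} :=
  Digraph (induced_loopless D S).

(* The library's [cycle] holds of the empty sequence, which is not a directed
   cycle. A one-vertex cycle would be a loop, and [:: u; v] is a cycle iff both
   uv and vu are arcs. *)
Definition acyclic (V : finType) (D : digraph V) : Prop :=
  forall c : seq V, ucycle (arcb D) c -> c = [::].

Definition acyclic_hom (V W : finType) (D : digraph V) (C : digraph W)
    (rho : V -> W) : Prop :=
  (forall u v, arcb D u v -> rho u = rho v \/ arcb C (rho u) (rho v)) /\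
  (forall w : W, acyclic (induced D [set v | rho v == w])).

Definition automorphism (V : finType) (D : digraph V) (f : V -> V) : Prop :=
  bijective f /\ (forall u v, arcb D (f u) (f v) = arcb D u v).

Definition is_core (V : finType) (D : digraph V) : Prop :=
  forall rho : V -> V, acyclic_hom D D rho -> automorphism D rho.

(* Probability that D(n,p) is the given digraph; the vertex set {1,...,n} is
   represented by 'I_n. *)
Definition Dnp_mass (R : realType) (n : nat) (p : R) (D : digraph 'I_n) : R :=
  \prod_(e : 'I_n * 'I_n | e.1 != e.2)
     (if arcb D e.1 e.2 then p else 1 - p).

Definition Dnp_prob (R : realType) (n : nat) (p : R)
    (P : digraph 'I_n -> Prop) : R :=
  \sum_(D : digraph 'I_n | `[< P D >]) Dnp_mass p D.

Lemma Dnp_mass_ge0 (R : realType) (n : nat) (p : R) (D : digraph 'I_n) :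
  0 <= p <= 1 -> 0 <= Dnp_mass p D.
Proof.
move=> /andP[p0 p1]; apply: prodr_ge0 => e _.
by case: ifP => // _; rewrite subr_ge0.
Qed.

Lemma Dnp_prob_setT (R : realType) (n : nat) (p : R) :
  Dnp_prob p (fun _ : digraph 'I_n => True) = 1.
Proof.
pose F (e : 'I_n * 'I_n) : R := if e.1 != e.2 then p else 0.
pose G (e : 'I_n * 'I_n) : R := if e.1 != e.2 then 1 - p else 1.
have FG1 : \prod_e (F e + G e) = 1.
  by apply: big1 => e _; rewrite /F /G; case: ifP => _; rewrite ?add0r // addrC subrK.
rewrite -FG1 bigA_distr.
rewrite (bigID (fun A : {set 'I_n * 'I_n} => [forall v, (v, v) \notin A])) /=.
rewrite [X in _ = _ + X]big1 ?addr0; last first.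
  move=> A /forallPn[v]; rewrite negbK => vA.
  by rewrite (bigD1 (v, v)) //= vA /F /= eqxx mul0r.
have -> : Dnp_prob p (fun _ : digraph 'I_n => True) =
    \sum_(D : digraph 'I_n) Dnp_mass p D.
  by apply: eq_bigl => D; rewrite asboolT.
rewrite [RHS](reindex_omap (@arcs _) insub) /=; last first.
  by move=> A lA; rewrite insubT.
apply: eq_big => [D|D _].
  by rewrite (valK D) eqxx andbT; symmetry; exact: arcs_loopless.
rewrite /Dnp_mass big_mkcond /=; apply: eq_bigr => -[u v] _ /=.
rewrite /F /G /arcb /=; case: eqVneq => [->|_] //=.
by have /forallP/(_ v)/negbTE -> := arcs_loopless D.
Qed.

(* Main.v *)
Require Import Defs.
From mathcomp Require Import all_boot all_order all_algebra.
From mathcomp Require Import all_classical all_reals all_analysis.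
From mathcomp Require Import ring lra.
Import Order.TTheory GRing.Theory Num.Theory.
Import numFieldNormedType.Exports.

Set Implicit Arguments.
Unset Strict Implicit.
Unset Printing Implicit Defensive.
Local Open Scope ring_scope.

(** The identity is a.a.s. the only acyclic homomorphism of the random digraph
    to itself; this is proved by two union bounds, with an integer [k] of order
    n^(2/9).

    First, a.a.s. every set of [k] vertices spans a digon (two opposite arcs).
    A given set of [k] vertices avoids its roughly k^2/2 potential digons with
    probability at most exp(-p^2 k(k-1)/4), and p^2 k is at least of order
    log^4 n, which beats the n^k choices.  Since the fibres of an acyclic
    homomorphism contain no digon, they have at most [k] elements.

    Second, let rho be a map other than the identity, with fibres of size at
    most [k], that moves m vertices.  If x is moved and y is outside the fibre
    containing x, then the pair e = (x, y) differs from its image rho(e), and rho can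
    only be a homomorphism if it is not the case that e is an arc and rho(e) is
    not; that bad pattern has probability p(1-p).  There are at least m(n-k)
    such pairs e.  Each vertex pair is the image of at most k^2 others, so a
    greedy choice ([disjoint_pairs]) keeps at least m(n-k)/(2k^2+2) of them for which
    the sets {e, rho(e)} are pairwise disjoint, hence independent.  Therefore
    rho preserves arcs with probability at most t^m, where
    t = exp(-p(1-p)(n-k)/(2k^2+2)) ([prob_arc_preserving]).  Summing t^m over
    all maps gives exactly (1+(n-1)t)^n ([sum_moved]), the identity
    contributing 1.  As n/k^2 is of order n^(5/9) and p(1-p) at least of order
    n^(-1/9), the weight t is smaller than n^(-3) and the rest of the sum tends
    to 0.

    Both bounds are instances of one estimate, [prob_no_forbidden], on a random
    set avoiding patterns on the pairs {i, f(i)} for a map f: f swaps the ends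
    of a pair in the first case and applies rho to both ends in the second. *)

(** * Random subsets with independent membership *)

Definition set_mass (R : pzRingType) (I : finType) (w : I -> R)
    (A : {set I}) : R :=
  \prod_i (if i \in A then w i else 1 - w i).

Lemma sum_set_mass (R : comPzRingType) (I : finType) (w : I -> R) :
  \sum_(A : {set I}) set_mass w A = 1.
Proof.
transitivity (\prod_i (w i + (1 - w i))); first by rewrite bigA_distr.
by apply: big1 => i _; rewrite addrCA subrr addr0.
Qed.

Lemma set_mass_ge0 (R : realType) (I : finType) (w : I -> R) (A : {set I}) :
  (forall i, 0 <= w i <= 1) -> 0 <= set_mass w A.
Proof.
move=> w01; apply: prodr_ge0 => i _.
by case/andP: (w01 i) => ? ?; case: ifP => // _; rewrite subr_ge0.
Qed.

(** Drawing the membership of one element again, independently of everything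
    else, does not change the distribution.  This is how independence enters:
    a factor of [G] that ignores [i] is the same in both terms on the right. *)
Lemma resample (R : comPzRingType) (I : finType) (w : I -> R) (i : I)
    (G : {set I} -> R) :
  \sum_(A : {set I}) set_mass w A * G A =
  \sum_(A : {set I}) set_mass w A *
    (w i * G (i |: A) + (1 - w i) * G (A :\ i)).
Proof.
have split (H : {set I} -> R) : \sum_(A : {set I}) set_mass w A * H A =
    \sum_(A : {set I} | i \notin A)
      (\prod_(j | j != i) (if j \in A then w j else 1 - w j)) *
      (w i * H (i |: A) + (1 - w i) * H A).
  rewrite (bigID (fun A : {set I} => i \in A)) /= addrC.
  rewrite [X in _ + X = _](reindex_onto (fun A => i |: A) (fun A => A :\ i)) /=;
    last by move=> A iA; rewrite finset.setD1K.
  rewrite [X in _ + X = _](eq_bigl (fun A : {set I} => i \notin A)); last first.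
    move=> A; rewrite finset.setU11 /=; apply/eqP/idP => [<-|iA].
      by rewrite !inE eqxx.
    by rewrite finset.setU1K.
  rewrite -big_split /=; apply: eq_bigr => A iA.
  have massE B : set_mass w B = (if i \in B then w i else 1 - w i) *
      \prod_(j | j != i) (if j \in B then w j else 1 - w j) by exact: bigD1.
  rewrite !massE finset.setU11 (negbTE iA).
  have -> : \prod_(j | j != i) (if j \in i |: A then w j else 1 - w j) =
      \prod_(j | j != i) (if j \in A then w j else 1 - w j).
    by apply: eq_bigr => j ji; rewrite !inE (negbTE ji).
  by set P := \prod_(_ | _) _; ring.
rewrite !split; apply: eq_bigr => A iA; congr (_ * _).
have -> : i |: (i |: A) = i |: A by apply/setP => j; rewrite !inE orbA orbb.
have -> : A :\ i = A by apply/setP => j; rewrite !inE; case: eqVneq iA => // -> /negbTE ->.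
rewrite finset.setU1K //; ring.
Qed.

(** The boolean [b] selects one of two forbidden patterns for a pair [(i, f i)]:
    both elements present, or [i] present and [f i] absent.  No element occurs
    twice in [s ++ map f s], so the pairs are independent and the probability
    of avoiding all of them is a power; the induction redraws the two elements
    of one pair at a time. *)
Lemma sum_forbidden_pairs (R : comPzRingType) (I : finType) (w : I -> R) (p : R)
    (f : I -> I) (b : bool) (s : seq I) :
  uniq (s ++ map f s) -> {in s ++ map f s, forall i, w i = p} ->
  \sum_(A : {set I}) set_mass w A *
     (all (fun i => ~~ ((i \in A) && ((f i \in A) == b))) s)%:R =
  (1 - p * (if b then p else 1 - p)) ^+ size s.
Proof.
elim: s => [|a s IH] //= us ws.
  by under eq_bigr do rewrite mulr1; rewrite expr0 sum_set_mass.
have /and3P[] : [&& a \notin s ++ f a :: map f s, f a \notin s ++ map f s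
    & uniq (s ++ map f s)].
  by case/andP: us => -> /=; rewrite -(cat1s (f a)) uniq_catCA.
rewrite mem_cat inE !negb_or => /and3P[aS afa aF] fa us'.
have wa : w a = p by apply: ws; rewrite inE eqxx.
have wfa : w (f a) = p by apply: ws; rewrite inE mem_cat inE eqxx !orbT.
set F := fun A : {set I} => all (fun i => ~~ ((i \in A) && ((f i \in A) == b))) s.
have FE (A : {set I}) c (B : {set I}) : c \notin s ++ map f s -> (forall j, j != c -> (j \in A) = (j \in B)) ->
    F A = F B.
  move=> cs AB; apply: eq_in_all => i iS.
  rewrite !AB //; apply: contraNneq cs => <-; rewrite mem_cat ?iS //.
  by rewrite map_f ?orbT.
have FU A c : c \notin s ++ map f s -> F (c |: A) = F A.
  by move=> cs; apply: (FE _ c) => // j jc; rewrite !inE (negbTE jc).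
have FD A c : c \notin s ++ map f s -> F (A :\ c) = F A.
  by move=> cs; apply: (FE _ c) => // j jc; rewrite !inE jc.
have as' : a \notin s ++ map f s by rewrite mem_cat negb_or aS.
have faa : (f a == a) = false by rewrite eq_sym (negbTE afa).
rewrite (resample w a).
transitivity (\sum_A set_mass w A *
    ((F A)%:R * (p * ((f a \in A) != b)%:R + (1 - p)))).
  apply: eq_bigr => A _; congr (_ * _).
  rewrite -!/(F _) FU // FD // !inE eqxx faa /= wa.
  by case: (F A); rewrite ?andbF ?andbT /=; ring.
rewrite (resample w (f a)).
transitivity (\sum_A set_mass w A * (F A)%:R *
    (1 - p * (if b then p else 1 - p))).
  apply: eq_bigr => A _; rewrite -mulrA; congr (_ * _).
  rewrite FU // FD // !inE eqxx /= wfa.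
  by case: b {IH F FE FU FD} (F A) => -[] /=; ring.
rewrite -mulr_suml IH //; first by rewrite exprSr.
by move=> i; rewrite mem_cat => /orP[] iS; apply: ws; rewrite inE mem_cat inE iS ?orbT.
Qed.

(** A maximal family of pairwise disjoint pairs [{i, f i}] meets every such
    pair.  A given pair [{e, f e}] is met only by those of [e], of [f e], and
    of the preimages of [e] and of [f e], at most [2 * d + 2] in all. *)
Lemma disjoint_pairs (I : finType) (f : I -> I) (P : {set I}) (d : nat) :
  {in P, forall i, f i != i} ->
  (forall j, (#|[set i in P | f i == j]| <= d)%N) ->
  exists s : seq I, [/\ {subset s <= P}, uniq (s ++ map f s) &
    (#|P| <= size s * (2 * d + 2))%N].
Proof.
move=> fP fd.
pose ok (E : {set I}) := (E \subset P) && uniq (enum E ++ map f (enum E)).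
have ok0 : ok finset.set0 by rewrite /ok finset.sub0set enum_set0.
case: (arg_maxnP (fun E : {set I} => #|E|) ok0) => E /andP[EP uE] Emax.
exists (enum E); split => //.
  by move=> i; rewrite mem_enum; exact: (fintype.subsetP EP).
pose N (e : I) := [set e; f e] :|: [set i in P | f i == e] :|: [set i in P | f i == f e].
have cN e : (#|N e| <= 2 * d + 2)%N.
  rewrite (_ : (2 * d + 2 = 2 + d + d)%N); last by rewrite mul2n -addnn addnC addnA.
  apply: leq_trans (leq_card_setU _ _) (leq_add _ (fd _)).
  apply: leq_trans (leq_card_setU _ _) (leq_add _ (fd _)).
  by rewrite cards2; case: eqP.
have sub : P \subset \bigcup_(e in E) N e.
  apply/fintype.subsetP => i iP; apply: contraT => /bigcupP nN.
  have iN e : e \in E -> i \notin N e by move=> eE; apply/negP => H; apply: nN; exists e.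
  have iE : i \notin E by apply/negP => H; have := iN _ H; rewrite !inE eqxx.
  (* A pair meeting none of those of [E] could be added, against maximality. *)
  suff /Emax : ok (i |: E) by rewrite /= cardsU1 iE ltnn.
  rewrite /ok finset.subUset finset.sub1set iP EP /=.
  have pE : perm_eq (enum (i |: E)) (i :: enum E).
    apply: uniq_perm; rewrite ?enum_uniq //= ?mem_enum ?iE ?enum_uniq //.
    by move=> j; rewrite mem_enum !inE mem_enum.
  rewrite (perm_uniq (perm_cat pE (perm_map f pE))) /=.
  rewrite -cat1s uniq_catCA /= uE andbT.
  have H1 : f i \notin enum E ++ [seq f j | j <- enum E].
    rewrite mem_cat negb_or; apply/andP; split.
      apply/negP; rewrite mem_enum => /iN.
      by rewrite !inE iP eqxx !orbT.
    apply/mapP => -[e]; rewrite mem_enum => /iN + fe.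
    by rewrite !inE iP fe eqxx !orbT.
  have H2 : i \notin enum E ++ f i :: [seq f j | j <- enum E].
    rewrite mem_cat inE mem_enum (negbTE iE) eq_sym (negbTE (fP _ iP)) /=.
    by apply/mapP => -[e]; rewrite mem_enum => /iN + fe; rewrite !inE -fe eqxx orbT.
  rewrite H1 andbT; move: H2; by rewrite !mem_cat !inE.
apply: leq_trans (subset_leq_card sub) _.
rewrite -cardE -sum_nat_const.
elim/big_rec2 : _ => [|e A B _ H]; first by rewrite cards0.
apply: leq_trans (leq_card_setU _ _) _; exact: leq_add.
Qed.

(** The estimate behind both union bounds: the patterns indexed by [P] may
    overlap, but at the cost of the factor [2 * d + 2] in the exponent they
    behave as if they were independent. *)
Lemma prob_no_forbidden (R : realType) (I : finType) (w : I -> R) (p : R)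
    (f : I -> I) (b : bool) (P : {set I}) (d : nat) :
  (forall i, 0 <= w i <= 1) -> 0 <= p <= 1 ->
  {in P, forall i, w i = p /\ w (f i) = p} ->
  {in P, forall i, f i != i} ->
  (forall j, (#|[set i in P | f i == j]| <= d)%N) ->
  \sum_(A : {set I} | [forall i in P, ~~ ((i \in A) && ((f i \in A) == b))])
     set_mass w A <=
  expR (- (p * (if b then p else 1 - p) * #|P|%:R / (2 * d + 2)%:R)).
Proof.
move=> w01 /andP[p0 p1] wP fP fd.
have [s [sP us Ps]] := disjoint_pairs fP fd.
set r := p * _.
have r01 : 0 <= r <= 1.
  by rewrite /r; case: (b); nra.
apply: (@le_trans _ _ ((1 - r) ^+ size s)).
  rewrite -(@sum_forbidden_pairs R I w p f b s us).
    rewrite big_mkcond ler_sum // => A _.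
    case: ifP => [/forall_inP H|_]; last by rewrite mulr_ge0 ?set_mass_ge0.
    rewrite (_ : all _ s) ?mulr1 //; apply/allP => i /sP; exact: H.
  move=> i; rewrite mem_cat => /orP[/sP/wP[]//|/mapP[j /sP /wP[] _ + ->]] //.
apply: (@le_trans _ _ (expR (- r) ^+ size s)).
  apply: lerXn2r; rewrite ?nnegrE ?expR_ge0 //; first by lra.
  by have := expR_ge1Dx (- r).
rewrite -expRM_natl ler_expR mulrN lerN2.
rewrite ler_pdivrMr ?ltr0n ?addn2 // -addn2 [leRHS]mulrAC -natrM mulrC.
by rewrite ler_wpM2r ?ler_nat //; case/andP: r01.
Qed.

Lemma union_bound (R : realType) (I T : finType) (w : I -> R) (P : pred T)
    (Q : T -> pred {set I}) :
  (forall i, 0 <= w i <= 1) ->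
  \sum_(A | [exists x, P x && Q x A]) set_mass w A <=
  \sum_(x | P x) \sum_(A | Q x A) set_mass w A.
Proof.
move=> w01; under [leRHS]eq_bigr do rewrite big_mkcond.
rewrite exchange_big /= big_mkcond ler_sum // => A _.
have m0 := set_mass_ge0 A w01.
have s0 (P' : pred T) : 0 <= \sum_(x | P' x) (if Q x A then set_mass w A else 0).
  by apply: sumr_ge0 => x _; case: ifP.
case: ifP => // /existsP[x /andP[Px QxA]].
rewrite (bigD1 x) //= QxA lerDl; exact: s0.
Qed.

(** * Random digraphs as random arc sets *)

(** The weight vanishes on the diagonal, so that a random set of pairs drawn
    with these weights is almost surely loopless. *)
Definition arc_weight (R : pzRingType) (V : eqType) (p : R) (e : V * V) : R :=
  if e.1 != e.2 then p else 0.

Lemma Dnp_prob_arcs (R : realType) (n : nat) (p : R)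
    (Q : pred {set 'I_n * 'I_n}) :
  Dnp_prob p (fun D : digraph 'I_n => Q (arcs D)) =
  \sum_(A | Q A) set_mass (arc_weight p) A.
Proof.
rewrite [RHS](bigID (fun A : {set 'I_n * 'I_n} => [forall v, (v, v) \notin A])) /=.
rewrite [X in _ = _ + X]big1 ?addr0; last first.
  move=> A /andP[_ /forallPn[v]]; rewrite negbK => vA.
  by rewrite /set_mass (bigD1 (v, v)) //= vA /arc_weight /= eqxx mul0r.
rewrite [RHS](reindex_omap (@arcs _) insub) /=; last first.
  by move=> A /andP[_ lA]; rewrite insubT.
apply: eq_big => [D|D _].
  by rewrite (valK D) eqxx andbT arcs_loopless andbT asboolb.
rewrite /Dnp_mass big_mkcond /=; apply: eq_bigr => -[u v] _ /=.
rewrite /arc_weight /arcb /=; case: eqVneq => [->|_] //=.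
by have /forallP/(_ v)/negbTE -> := arcs_loopless D; rewrite subr0.
Qed.

(** * A digraph without the two bad configurations is a core *)

Definition swap (V : Type) (e : V * V) : V * V := (e.2, e.1).
Definition offdiag (V : finType) (S : {set V}) : {set V * V} :=
  [set e | [&& e.1 \in S, e.2 \in S & e.1 != e.2]].
(** Written, like [arc_preserving] below, as the avoidance of a pattern on
    pairs [(e, f e)], so that [prob_no_forbidden] applies as is. *)
Definition digon_free (V : finType) (S : {set V}) (A : {set V * V}) : bool :=
  [forall e in offdiag S, ~~ ((e \in A) && ((swap e \in A) == true))].

Definition map_pair (V : Type) (rho : V -> V) (e : V * V) : V * V :=
  (rho e.1, rho e.2).
(** A moved first end makes the pair differ from its image, and distinct images
    of the two ends force the image of an arc to be an arc. *)
Definition moved_pairs (V : finType) (rho : V -> V) : {set V * V} :=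
  [set e | (rho e.1 != e.1) && (rho e.1 != rho e.2)].
Definition arc_preserving (V : finType) (rho : V -> V) (A : {set V * V}) : bool :=
  [forall e in moved_pairs rho, ~~ ((e \in A) && ((map_pair rho e \in A) == false))].
Definition moved (V : finType) (rho : V -> V) : {set V} :=
  [set x | rho x != x].
Definition small_fibres (V : finType) (k : nat) (rho : V -> V) : bool :=
  [forall w, #|[set v | rho v == w]| <= k]%N.

(** Of the acyclicity of the fibres only the absence of directed 2-cycles is
    kept; this already bounds their size. *)
Lemma digon_free_fibre (V : finType) (D : digraph V) (rho : V -> V) (w : V) :
  acyclic_hom D D rho -> digon_free [set v | rho v == w] (arcs D).
Proof.
move=> [_ /(_ w) ac]; apply/forall_inP => -[u v]; rewrite !inE /= eqb_id.
move=> /and3P[uw vw uv]; apply/negP => /andP[uvD vuD].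
have uS : u \in [set v | rho v == w] by rewrite inE.
have vS : v \in [set v | rho v == w] by rewrite inE.
have /ac // : ucycle (arcb (Defs.induced D [set v | rho v == w]))
  [:: exist _ u uS; exist _ v vS].
rewrite /ucycle /ucycleb /= !inE /arcb /= !inE /arcb /= uvD vuD /= andbT.
by rewrite -val_eqE /=.
Qed.

(** A fibre with more than [k] elements would contain a digon-free set of
    exactly [k] vertices, so the fibres of an acyclic endomorphism are small;
    such an endomorphism preserves arcs, hence is the identity.  The criterion
    thus gives more than a core: it forces the digraph to be rigid. *)
Lemma is_core_criterion (V : finType) (D : digraph V) (k : nat) :
  (forall S : {set V}, #|S| = k -> ~~ digon_free S (arcs D)) ->
  (forall rho : {ffun V -> V}, rho != [ffun x => x] -> small_fibres k rho ->
     ~~ arc_preserving rho (arcs D)) ->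
  is_core D.
Proof.
move=> noS norho rho hrho.
have fib : small_fibres k rho.
  apply/forallP => w; rewrite leqNgt; apply/negP => kw.
  have [S Sw Sk] : exists2 S : {set V}, S \subset [set v | rho v == w] & #|S| = k.
    set F := [set v | _] in kw *.
    have : (0 < #|[set B : {set V} | (B \subset F) && (#|B| == k)]|)%N.
      by rewrite cards_draws bin_gt0 ltnW.
    by rewrite card_gt0 => /set0Pn[B]; rewrite inE => /andP[? /eqP ?]; exists B.
  have /negP[] := noS S Sk.
  apply/forall_inP => e; rewrite inE => /and3P[e1 e2 e12].
  apply: (forall_inP (digon_free_fibre w hrho)).
  by rewrite inE !(fintype.subsetP Sw).
have rhoE : rho =1 id.
  case: (eqVneq (finfun rho) [ffun x => x]) => [/ffunP E x|/norho].
    by have := E x; rewrite !ffunE.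
  rewrite (_ : small_fibres k _ = true); last first.
    rewrite -fib; apply: eq_forallb => w; congr (_ <= _)%N.
    by apply: eq_card => v; rewrite !inE ffunE.
  move=> /(_ isT)/negP[]; apply/forall_inP => -[u v].
  rewrite !inE /map_pair /= !ffunE => /andP[_ ruv].
  rewrite negb_and; case: (boolP (_ \in _)) => //= uvD; rewrite eqbF_neg negbK.
  by case: hrho => /(_ u v uvD) [/eqP E|] // _; rewrite E in ruv.
split; first by exists id => x; rewrite rhoE.
by move=> u v; rewrite !rhoE.
Qed.

(** * Probabilities of the bad configurations *)

Lemma arc_weight_bounds (R : realType) (V : finType) (p : R) (e : V * V) :
  0 <= p <= 1 -> 0 <= arc_weight p e <= 1.
Proof. by move=> p01; rewrite /arc_weight; case: ifP; rewrite ?lexx ?ler01. Qed.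

(** The two orientations of an edge are exchanged by [swap], whose fibres are
    singletons: here [d = 1], whence the denominator [4]. *)
Lemma prob_digon_free (R : realType) (V : finType) (p : R) (S : {set V}) :
  0 <= p <= 1 ->
  \sum_(A | digon_free S A) set_mass (arc_weight p) A <=
  expR (- (p * p * (#|S| * #|S|.-1)%:R / 4%:R)).
Proof.
move=> p01.
have -> : (#|S| * #|S|.-1)%N = #|offdiag S|.
  rewrite -[RHS]sum1_card (eq_bigl (fun e => (e.1 \in S) && (e.2 \in S :\ e.1))); last first.
    by move=> e; rewrite !inE [_ && (e.1 != _)]andbC eq_sym.
  rewrite -(pair_big_dep (fun x => x \in S) (fun x y => y \in S :\ x) (fun _ _ => 1%N)) /=.
  rewrite -sum_nat_const; apply: eq_bigr => x xS.
  by rewrite sum1_card (cardsD1 x S) xS.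
apply: (@prob_no_forbidden R _ (arc_weight p) p (@swap V) true (offdiag S) 1) => //.
- by move=> e; apply: arc_weight_bounds.
- move=> e; rewrite inE => /and3P[_ _ e12].
  by rewrite /arc_weight /= e12 eq_sym e12.
- move=> [u v]; rewrite inE => /and3P[_ _ /= uv].
  by rewrite xpair_eqE negb_and /= uv orbT.
- move=> j; rewrite -(cards1 (swap j)); apply: subset_leq_card.
  by apply/fintype.subsetP => -[u v]; rewrite !inE => /andP[_ /eqP <-].
Qed.

(** For a moved [x], every [y] outside the fibre containing [x] gives a pair. *)
Lemma card_moved_pairs (V : finType) (rho : V -> V) (k : nat) :
  small_fibres k rho ->
  (#|moved rho| * (#|V| - k) <= #|moved_pairs rho|)%N.
Proof.
move=> /forallP fib; rewrite -[leqRHS]sum1_card.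
rewrite (eq_bigl (fun e => (rho e.1 != e.1) && (rho e.1 != rho e.2))); last first.
  by move=> e; rewrite inE.
rewrite -(pair_big_dep (fun x => rho x != x) (fun x y => rho x != rho y) (fun _ _ => 1%N)) /=.
rewrite -sum_nat_const (eq_bigl (fun x => rho x != x)); last by move=> x; rewrite inE.
apply: leq_sum => x _; rewrite sum1_card leq_subLR.
have := fib (rho x); rewrite -(leq_add2r #|[pred y | rho x != rho y]|).
apply: leq_trans; rewrite -(cardC [set v | rho v == rho x]) leq_add2l.
by apply: eq_leq; apply: eq_card => y; rewrite !inE eq_sym.
Qed.

(** A fibre of [map_pair rho] is a product of two fibres of [rho], so [d] is
    [k ^ 2].  The bound is a power of a quantity independent of [rho], whose
    exponent is the number of moved vertices. *)
Lemma prob_arc_preserving (R : realType) (V : finType) (p : R) (k : nat)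
    (rho : V -> V) :
  0 <= p <= 1 -> small_fibres k rho ->
  \sum_(A | arc_preserving rho A) set_mass (arc_weight p) A <=
  expR (- (p * (1 - p) * (#|V| - k)%:R / (2 * k ^ 2 + 2)%:R)) ^+ #|moved rho|.
Proof.
move=> p01 fib.
have/andP [p0 p1] := p01.
apply: le_trans (@prob_no_forbidden R _ (arc_weight p) p (map_pair rho) false
  (moved_pairs rho) (k ^ 2) _ p01 _ _ _) _.
- by move=> e; apply: arc_weight_bounds.
- move=> e; rewrite inE => /andP[_ e12].
  have e12' : e.1 != e.2 by apply: contraNneq e12 => ->.
  by rewrite /arc_weight /= e12 e12'.
- by move=> [u v]; rewrite inE /map_pair xpair_eqE /= => /andP[/negbTE ->].
- move=> j; apply: (@leq_trans #|finset.setX [set v | rho v == j.1] [set v | rho v == j.2]|).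
    apply: subset_leq_card; apply/fintype.subsetP => e; rewrite !inE.
    by move=> /andP[_ /eqP <-]; rewrite /map_pair /= !eqxx.
  by rewrite cardsX -mulnn; apply: leq_mul; apply: (forallP fib).
rewrite -expRM_natl ler_expR mulrN lerN2 mulrA.
rewrite ler_wpM2r ?invr_ge0 // mulrCA -natrM.
by rewrite ler_wpM2l ?ler_nat ?card_moved_pairs // mulr_ge0 // subr_ge0.
Qed.

(** Each vertex chooses its image independently, with factor [1] for itself and
    [t] for any other vertex, so the sum over all maps factors over vertices. *)
Lemma sum_moved (R : comPzRingType) (V : finType) (t : R) :
  \sum_(rho : {ffun V -> V} | rho != [ffun x => x]) t ^+ #|moved rho| =
  (1 + #|V|.-1%:R * t) ^+ #|V| - 1.
Proof.
have : \sum_(rho : {ffun V -> V}) t ^+ #|moved rho| =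
    (1 + #|V|.-1%:R * t) ^+ #|V|.
  rewrite -[RHS]prodr_const /=.
  transitivity (\prod_(x : V) \sum_(y : V) (if y != x then t else 1)); last first.
    apply: eq_bigr => x _; rewrite (bigD1 x) //= eqxx /=; congr (_ + _).
    rewrite (eq_bigr (fun=> t)); last by move=> y ->.
    by rewrite sumr_const cardC1 mulr_natl.
  rewrite bigA_distr_bigA; apply: eq_bigr => rho _.
  rewrite -big_mkcond /= prodr_const; congr (_ ^+ _).
  by apply: eq_card => x; rewrite !inE.
rewrite (bigD1 [ffun x => x]) //= => <-.
rewrite (_ : #|moved _| = 0%N); first by rewrite expr0 addrAC subrr add0r.
by apply/eqP; rewrite cards_eq0; apply/eqP/setP => x; rewrite !inE ffunE eqxx.
Qed.

(** Union bound over the sets of [k] vertices, of which there are at most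
    [n ^ k], and over the maps other than the identity. *)
Lemma prob_not_core (R : realType) (n : nat) (p : R) (k : nat) :
  0 <= p <= 1 ->
  1 - Dnp_prob p (fun D : digraph 'I_n => is_core D) <=
  n%:R ^+ k * expR (- (p * p * (k * k.-1)%:R / 4%:R)) +
  ((1 + n%:R * expR (- (p * (1 - p) * (n - k)%:R / (2 * k ^ 2 + 2)%:R))) ^+ n - 1).
Proof.
move=> p01; set t := expR (- (p * (1 - p) * _ / _)).
have w01 (e : 'I_n * 'I_n) : 0 <= arc_weight p e <= 1 by exact: arc_weight_bounds.
pose bad1 (A : {set 'I_n * 'I_n}) := [exists S : {set 'I_n}, (#|S| == k) && digon_free S A].
pose bad2 (A : {set 'I_n * 'I_n}) := [exists rho : {ffun 'I_n -> 'I_n},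
  (rho != [ffun x => x]) && small_fibres k rho && arc_preserving rho A].
have H0 : 1 - Dnp_prob p (fun D : digraph 'I_n => is_core D) <=
    \sum_(A | bad1 A) set_mass (arc_weight p) A + \sum_(A | bad2 A) set_mass (arc_weight p) A.
  rewrite -!Dnp_prob_arcs lerBlDr -(Dnp_prob_setT n p) /Dnp_prob.
  rewrite [leLHS]big_mkcond /= ![X in _ <= X + _ + _]big_mkcond.
  rewrite ![X in _ <= _ + X + _]big_mkcond ![X in _ <= _ + X]big_mkcond /=.
  rewrite -!big_split /= ler_sum // => D _.
  have m0 := Dnp_mass_ge0 D p01.
  rewrite (asboolT I) !asboolb.
  case: (boolP (bad1 _)) => [_|/existsPn b1].
    by rewrite -addrA lerDl addr_ge0 //; case: ifP.
  case: (boolP (bad2 _)) => [_|/existsPn b2].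
    by rewrite add0r lerDl; case: ifP.
  rewrite asboolT ?add0r //; apply: (@is_core_criterion _ _ k) => [S Sk|rho r1 r2].
    by have := b1 S; rewrite Sk eqxx.
  by have := b2 rho; rewrite r1 r2.
apply: le_trans H0 _; apply: lerD.
  apply: le_trans (union_bound _ _ w01) _.
  apply: (@le_trans _ _ (\sum_(S : {set 'I_n} | #|S| == k)
      expR (- (p * p * (k * k.-1)%:R / 4%:R)))).
    by apply: ler_sum => S /eqP Sk; rewrite -Sk; exact: prob_digon_free.
  rewrite sumr_const -[leLHS]mulr_natl ler_wpM2r ?expR_ge0 // -natrX ler_nat.
  have -> : #|[pred S : {set 'I_n} | #|S| == k]| = 'C(n, k).
    by rewrite -[X in 'C(X, _)](card_ord n) -card_draws; apply: eq_card => S; rewrite !inE.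
  apply: (@leq_trans ('C(n, k) * k`!)); first by rewrite leq_pmulr // fact_gt0.
  (* ['C(n, k) * k`!] counts the injections of ['I_k] into ['I_n]. *)
  have := max_card [set f : {ffun 'I_k -> 'I_n} | injectiveb f].
  by rewrite card_inj_ffuns card_ffun !card_ord bin_ffact.
apply: le_trans (union_bound _ _ w01) _.
apply: (@le_trans _ _ (\sum_(rho : {ffun 'I_n -> 'I_n} | rho != [ffun x => x])
    t ^+ #|moved rho|)).
  rewrite [leLHS]big_mkcondr /=; apply: ler_sum => rho _.
  case: ifP => fib; last by rewrite exprn_ge0 ?expR_ge0.
  by rewrite /t -[X in (X - k)%N](card_ord n) prob_arc_preserving.
rewrite sum_moved card_ord lerD2r lerXn2r ?nnegrE ?addr_ge0 ?mulr_ge0 ?expR_ge0 //.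
by rewrite lerD2l ler_wpM2r ?expR_ge0 // ler_nat leq_pred.
Qed.

(** * Asymptotics *)

(** With [L = ln n] and [x = n ^ (1/9)], both [p] and [1 - p] exceed [L ^ 2 / x].
    The choice of [k] just above [x ^ 2] makes [p ^ 2 * (k - 1) >= L ^ 4], which
    beats the entropy [L] per vertex of the set, while the second exponent is
    of order [L ^ 2 * x ^ 9 / (x * k ^ 2)], that is [L ^ 2 * x ^ 4].  The
    threshold [240] absorbs the constants: [60 * L * x ^ 4 <= L ^ 2 * x ^ 8 / 4]
    as soon as [240 <= L * x ^ 4]. *)
Lemma prob_core_ge (R : realType) (n : nat) (p : R) :
  240%:R <= ln (n%:R : R) ->
  n%:R `^ (- (1 / 9%:R)) * (ln n%:R) ^+ 2 < p
    < 1 - n%:R `^ (- (1 / 9%:R)) * (ln n%:R) ^+ 2 ->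
  1 - 3%:R / n%:R <= Dnp_prob p (fun D : digraph 'I_n => is_core D).
Proof.
move=> L240; set L := ln n%:R in L240 *.
have n0 : (0 : R) < n%:R.
  rewrite ltr0n lt0n; apply: contraTneq L240 => n0.
  by rewrite /L n0 ln0 // -ltNge; lra.
have nE : n%:R = expR L by rewrite lnK.
pose x := expR (L / 9%:R).
have x27 : 27%:R <= x.
  by have := expR_ge1Dx (L / 9%:R); rewrite -/x; lra.
have x0 : 0 < x by lra.
have nx : n%:R = x ^+ 9 by rewrite nE /x -expRM_natl; congr expR; field.
have -> : n%:R `^ (- (1 / 9%:R)) = x^-1.
  by rewrite /powR gt_eqF // -/L /x -expRN; congr expR; field.
set d := x^-1 * L ^+ 2 => /andP[dp pd].
have dx : d * x = L ^+ 2 by rewrite /d mulrAC mulVf ?mul1r // gt_eqF.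
have d0 : 0 <= d by rewrite /d mulr_ge0 ?invr_ge0 ?sqr_ge0 // ltW.
have p01 : 0 <= p <= 1 by lra.
pose k := (Num.truncn (x ^+ 2)).+2.
have [k1 k2] : x ^+ 2 <= k.-1%:R /\ k%:R <= 3%:R * x ^+ 2.
  have /andP[h1 h2] := truncn_itv (sqr_ge0 x).
  split; first exact: ltW.
  by rewrite /k -addn2 natrD; nra.
have kk : k%:R = 1 + k.-1%:R :> R by rewrite -natr1 addrC.
have k3 : (1 : R) <= k%:R by rewrite ler1n.
clearbody k.
have pq : d / 2%:R <= p * (1 - p).
  case: (lerP p (1 / 2%:R)) => hp; nra.
have nV : n%:R^-1 = expR (- L) by rewrite expRN nE.
(* The expected number of digon-free sets of size [k]. *)
have T1 : n%:R ^+ k * expR (- (p * p * (k * k.-1)%:R / 4%:R)) <= n%:R^-1.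
  rewrite nV nE -expRM_natl -expRD ler_expR natrM.
  have h1 : L ^+ 4 <= p * p * k.-1%:R.
    apply: (@le_trans _ _ (d * d * x ^+ 2)).
      have -> : L ^+ 4 = (L ^+ 2) ^+ 2 by rewrite -exprM.
      by rewrite -dx exprMn expr2.
    apply: ler_pM => //; [exact: mulr_ge0 | exact: sqr_ge0 |].
    by apply: ler_pM => //; exact: ltW.
  have h2 : 8%:R * L <= L ^+ 4.
    rewrite exprSr ler_wpM2r //; first by lra.
    by apply: (@le_trans _ _ (L ^+ 1)); [rewrite expr1; lra | apply: ler_weXn2l => //; lra].
  have -> : p * p * (k%:R * k.-1%:R) / 4%:R = k%:R * (p * p * k.-1%:R / 4%:R) by ring.
  have : k%:R * (2%:R * L) <= k%:R * (p * p * k.-1%:R / 4%:R).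
    by rewrite ler_wpM2l //; lra.
  nra.
(* The weight of one moved vertex, summed over its possible images. *)
have nL3 : n%:R * expR (- (p * (1 - p) * (n - k)%:R / (2 * k ^ 2 + 2)%:R)) <= expR (- (2%:R * L)).
  rewrite nE -expRD ler_expR.
  set tau := (X in - X); suff : 3%:R * L <= tau by lra.
  rewrite /tau.
  have D0 : (0 : R) < (2 * k ^ 2 + 2)%:R by rewrite ltr0n addn2.
  rewrite ler_pdivlMr // natrD natrM natrX.
  have x7 : 6%:R <= x ^+ 7.
    apply: (@le_trans _ _ (x ^+ 1)); first by rewrite expr1; lra.
    by apply: ler_weXn2l => //; lra.
  have kn : (k%:R : R) <= n%:R / 2%:R.
    rewrite nx (_ : x ^+ 9 = x ^+ 2 * x ^+ 7); last by rewrite -exprD.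
    have : 0 <= x ^+ 2 by rewrite sqr_ge0.
    nra.
  have kn' : (k <= n)%N by rewrite -(ler_nat R); lra.
  rewrite natrB //.
  have h1 : n%:R / 2%:R <= n%:R - k%:R :> R by lra.
  (* [2 * 9 * x ^ 4 + 2 <= 20 * x ^ 4], from [k <= 3 * x ^ 2]. *)
  have h2 : 2%:R * k%:R ^+ 2 + 2%:R <= 20%:R * x ^+ 4.
    have : k%:R ^+ 2 <= (3%:R * x ^+ 2) ^+ 2.
      by apply: lerXn2r => //; rewrite nnegrE // mulr_ge0 // sqr_ge0.
    have : 1 <= x ^+ 4 by apply: exprn_ege1; lra.
    have -> : (3%:R * x ^+ 2) ^+ 2 = 9%:R * x ^+ 4 by ring.
    lra.
  apply: (@le_trans _ _ (3%:R * L * (20%:R * x ^+ 4))).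
    by rewrite ler_wpM2l //; lra.
  apply: (@le_trans _ _ (d / 2%:R * (n%:R / 2%:R))); last first.
    by apply: ler_pM => //; apply: divr_ge0 => //; exact: ltW.
  have -> : d / 2%:R * (n%:R / 2%:R) = L * (L * x ^+ 4) * x ^+ 4 / 4%:R.
    rewrite nx (_ : x ^+ 9 = x * x ^+ 8); last by rewrite -exprS.
    rewrite (_ : _ * _ = (d * x) * x ^+ 8 / 4%:R); last by field.
    by rewrite dx; ring.
  have x4 : 1 <= x ^+ 4 by apply: exprn_ege1; lra.
  have : 240%:R <= L * x ^+ 4 by nra.
  move=> h; rewrite [leLHS](_ : _ = L * 240%:R * x ^+ 4 / 4%:R); last by field.
  rewrite ler_wpM2r ?invr_ge0 // ler_wpM2r ?ler_wpM2l //; lra.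
have := prob_not_core n k p01; set t := n%:R * _ in nL3 *.
have nge : (2%:R : R) <= n%:R.
  by rewrite nE; apply: le_trans (expR_ge1Dx L); lra.
have tn : (1 + t) ^+ n <= 1 + 2%:R / n%:R.
  apply: (@le_trans _ _ (expR (n%:R^-1))).
    apply: (@le_trans _ _ (expR (expR (- (2%:R * L))) ^+ n)).
      have t0 : 0 <= t by rewrite /t mulr_ge0 ?expR_ge0.
      apply: lerXn2r; rewrite ?nnegrE ?expR_ge0 ?addr_ge0 //.
      by apply: le_trans (expR_ge1Dx _); rewrite lerD2l.
    rewrite -expRM_natl ler_expR nE -expRN -expRD ler_expR; lra.
  set y := n%:R^-1; have y2 : y <= 1 / 2%:R.
    by rewrite /y -div1r ler_pdivrMr //; lra.
  have y0 : 0 < y by rewrite invr_gt0.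
  (* [expR y <= 1 / (1 - y) <= 1 + 2 * y] for [0 < y <= 1 / 2]. *)
  have := expR_ge1Dx (- y); rewrite expRN => h.
  have e0 := expR_gt0 y.
  have : (1 - y) * expR y <= 1 by rewrite -ler_pdivlMr // div1r.
  by rewrite -/y; nra.
rewrite -[3%:R / _]/(3%:R * n%:R^-1); lra.
Qed.

Unset Implicit Arguments.
Set Strict Implicit.
Set Printing Implicit Defensive.
Local Open Scope classical_set_scope.
Local Open Scope ring_scope.

Theorem corollary3p2 (R : realType) (p : nat -> R)
  (p01 : forall n : nat, 0 <= p n <= 1)
  (hp : \forall n \near \oo,
     n%:R `^ (- (1 / 9%:R)) * (ln n%:R) ^+ 2 < p n
       < 1 - n%:R `^ (- (1 / 9%:R)) * (ln n%:R) ^+ 2) :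
  Dnp_prob (p n) (fun D : digraph 'I_n => is_core D) @[n --> \oo] --> (1 : R).
Proof.
apply: (@squeeze_cvgr _ _ _ _ (fun n => 1 - 3%:R / n%:R) (fun=> 1)).
- near=> n; apply/andP; split.
    apply: prob_core_ge; last by near: n.
    rewrite -ler_expR lnK; last first.
      by rewrite posrE ltr0n; near: n; exact: nbhs_infty_gt.
    by near: n; exact: nbhs_infty_ger.
  rewrite -(Dnp_prob_setT n (p n)) /Dnp_prob [leLHS]big_mkcond [leRHS]big_mkcond /=.
  apply: ler_sum => D _; rewrite (asboolT I).
  by case: ifP => // _; apply: Dnp_mass_ge0.
- rewrite -[X in _ --> X]subr0 -(mulr0 3%:R).
  apply: cvgB; first exact: cvg_cst.
  apply: cvgMl_tmp => //.
  by rewrite -(cvg_shiftS); exact: cvg_harmonic.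
- exact: cvg_cst.
Unshelve. all: by end_near.
Qed.
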